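(* Let $G$ be a bipartite planar graph with minimum degree $\delta(G) \ge 3$. Then $\overrightarrow{\chi}(G) \le 3$.
   Context: All graphs are finite and simple, with at least one vertex. An orientation $\sigma$ of $G$ is a digraph obtained from $G$ by replacing each edge by exactly one of the two possible arcs with the same end-vertices. For $v \in V(G)$, the indegree $d^-_{\sigma}(v)$ is the number of arcs of $\sigma$ incoming to $v$. A $k$-orientation is an orientation in which every vertex has indegree at most $k$. An orientation $\sigma$ is proper if $d^-_{\sigma}(u) \ne d^-_{\sigma}(v)$ for every edge $uv \in E(G)$. The proper orientation number $\overrightarrow{\chi}(G)$ is the minimum integer $k$ such that $G$ admits a proper $k$-orientation. *)

(* Defs.v *)
From HB Require Import structures.
From mathcomp Require Import all_boot all_order all_algebra.

Set Implicit Arguments.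
Unset Strict Implicit.
Unset Printing Implicit Defensive.

Record sgraph := SGraph {
  vertex :> finType;
  adj : rel vertex;
  adj_sym : symmetric adj;
  adj_irrefl : irreflexive adj;
  vertex_gt0 : 0 < #|vertex|
}.

Section Graphs.
Variable G : sgraph.
Implicit Types (u v w : G) (A : {set G * G}) (k : nat).

Definition edges : {set {set G}} :=
  [set [set p.1; p.2] | p in [set p : G * G | adj p.1 p.2]].

Definition degree v : nat := #|[set u | adj u v]|.

(* The default value #|G| exceeds every degree and G has a vertex, so this is
   the minimum of the degrees. *)
Definition min_degree : nat := \big[minn/#|G|]_(v : G) degree v.

Definition bipartite : Prop :=
  exists X : {set G}, forall u v, adj u v -> (u \in X) != (v \in X).

(* A digraph on the vertices of G is its set of arcs; (u, v) points from u to
   v. *)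
Definition orientation A : bool :=
  [forall u, forall v,
     if adj u v then ((u, v) \in A) (+) ((v, u) \in A) else (u, v) \notin A].

Definition indegree A v : nat := #|[set u | (u, v) \in A]|.

Definition properly_oriented A : bool :=
  [forall u, forall v, adj u v ==> (indegree A u != indegree A v)].

Definition proper_k_orientation k A : bool :=
  [&& orientation A, [forall v, indegree A v <= k] & properly_oriented A].

Definition has_proper_k_orientation k : bool :=
  [exists A, proper_k_orientation k A].

Lemma proper_orientation_on (S : {set G}) : exists A,
  [/\ forall u v, (u, v) \in A -> [&& u \in S, v \in S & adj u v],
      forall u v, u \in S -> v \in S -> adj u v ->
        ((u, v) \in A) (+) ((v, u) \in A)
    & forall u v, u \in S -> v \in S -> adj u v ->
        indegree A u != indegree A v].
Proof.
have [n] := ubnP #|S|; elim: n S => // n IHn S; rewrite ltnS => leSn.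
have [->|/set0Pn[x0 x0S]] := eqVneq S set0.
  by exists set0; split=> u v; rewrite !inE.
pose dS (v : G) := #|[set u in S | adj u v]|.
case: (arg_maxnP dS x0S) => x xS' xmax'.
have xS : x \in S := xS'.
have xmax u : u \in S -> dS u <= dS x := xmax' u.
have [|A [A1 A2 A3]] := IHn (S :\ x).
  by apply: leq_trans leSn; rewrite [in ltnRHS](cardsD1 x S) xS.
have xNA u : (u, x) \notin A by apply/negP => /A1; rewrite !inE eqxx andbF.
have xNA' u : (x, u) \notin A by apply/negP => /A1; rewrite !inE eqxx.
pose B := (A :|: [set p | [&& p.1 \in S, p.2 == x & adj p.1 x]]).
have Bx : indegree B x = dS x.
  by apply: eq_card => u; rewrite !inE /= eqxx (negPf (xNA u)).
have Bu u : u != x -> indegree B u = indegree A u.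
  by move=> ux; apply: eq_card => w; rewrite !inE /= (negPf ux) !andbF orbF.
have ltA u : u \in S -> u != x -> adj u x -> indegree B u < dS x.
  move=> uS ux aux; rewrite Bu //; apply: leq_trans (xmax u uS).
  apply: proper_card; apply/properP; split.
    apply/subsetP => w; rewrite !inE => /A1; rewrite !inE.
    by case/and3P=> /andP[_ ->] _ ->.
  by exists x; rewrite !inE ?(negPf (xNA' u)) // xS adj_sym.
exists B; split=> [u v|u v uS vS auv|u v uS vS auv].
- rewrite !inE /= => /orP[/A1|/and3P[uS /eqP-> ->]]; last by rewrite uS xS.
  by rewrite !inE => /and3P[/andP[_ ->] /andP[_ ->] ->].
- rewrite !inE /= uS vS /=.
  have [vx|vx] := eqVneq v x; have [ux|ux] := eqVneq u x.
  + by move: auv; rewrite vx ux adj_irrefl.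
  + by rewrite vx (negPf (xNA u)) (negPf (xNA' u)) -vx auv.
  + by rewrite ux (negPf (xNA v)) (negPf (xNA' v)) -ux adj_sym auv.
  + by rewrite !orbF; apply: A2; rewrite // !inE ?ux ?vx.
- have [vx|vx] := eqVneq v x; have [ux|ux] := eqVneq u x.
  + by move: auv; rewrite vx ux adj_irrefl.
  + by rewrite vx Bx neq_ltn ltA // -vx.
  + by rewrite ux Bx eq_sym neq_ltn ltA // -ux adj_sym.
  + by rewrite !Bu //; apply: A3; rewrite // !inE ?ux ?vx.
Qed.

Lemma has_proper_k_orientation_ex : exists k, has_proper_k_orientation k.
Proof.
have [A [A1 A2 A3]] := proper_orientation_on setT.
exists #|G|; apply/existsP; exists A; apply/and3P; split.
- apply/forallP => u; apply/forallP => v; case: ifPn => auv.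
    by apply: A2; rewrite ?inE.
  by apply: contra auv => /A1 /and3P[].
- by apply/forallP => v; apply: max_card.
- apply/forallP => u; apply/forallP => v; apply/implyP => auv.
  by apply: A3; rewrite ?inE.
Qed.

Definition proper_orientation_number : nat :=
  ex_minn has_proper_k_orientation_ex.

End Graphs.

From mathcomp Require Import all_classical all_reals all_analysis.
Import numFieldNormedType.Exports.
Local Open Scope classical_set_scope.

(* A drawing of G in the plane: pos places the vertices, and the edge e is
   drawn as the simple arc arc e @` `[0, 1]. *)
Definition plane_drawing (R : realType) (G : sgraph)
    (pos : G -> R * R) (arc : {set G} -> R -> R * R) : Prop :=
  [/\ injective pos,
      forall e, e \in edges G ->
        [/\ {within `[0%R, 1%R], continuous (arc e)},
            {in `[0%R, 1%R]%R &, injective (arc e)}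
          & exists u v : G,
              [/\ e = [set u; v]%SET, arc e 0%R = pos u & arc e 1%R = pos v]],
      forall e (v : G) (t : R), e \in edges G -> (0 < t < 1)%R ->
        arc e t <> pos v
    & forall e f (s t : R), e \in edges G -> f \in edges G -> e != f ->
        (0 < s < 1)%R -> (0 < t < 1)%R -> arc e s <> arc f t].

Definition planar (R : realType) (G : sgraph) : Prop :=
  exists pos arc, @plane_drawing R G pos arc.

(* Main.v *)
Require Import Defs.
From mathcomp Require Import all_boot all_order all_algebra.
From mathcomp Require Import all_classical all_reals all_analysis.
From mathcomp Require Import fintype finset zify lra.

Set Implicit Arguments.
Unset Strict Implicit.
Unset Printing Implicit Defensive.

Import Order.TTheory GRing.Theory Num.Theory numFieldNormedType.Exports.

(** A bipartite planar graph has at most 2|V| edges, and so does each of its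
induced subgraphs.  By the orientation theorem of Hakimi
([bounded_indegree_orientation]) the graph therefore has an orientation in
which all indegrees are at most 2.  Let X be one side of the bipartition.
Every vertex of X has degree at least 3, and X is independent, so arcs leaving
a vertex of X can be reversed, independently at each vertex of X, until its
indegree is exactly 3 ([saturate_side]); reversals only lower the indegrees of
the vertices outside X, which stay at most 2.  Adjacent vertices now have
different indegrees.

The bulk of the work is the edge bound for a drawing whose arcs are arbitrary
continuous curves.  Neither the Jordan curve theorem nor faces of the drawing
in the plane are used: the drawing is replaced by a picture in the square
lattice, where the topology becomes linear algebra over the field with two
elements, booleans under exclusive or.

From curves to the lattice ([curves_card]).  Cut every edge xy, with x in X,
at its midpoint.  Compactness gives a positive distance between any two pieces
that do not meet, so the curves can be sampled and rounded to a fine lattice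
without creating new incidences.  The blob of y is the set of lattice points
that come from the second halves of the edges at y; the blob of x consists of
the samples of each edge xy up to its first visit to the blob of y.  Blobs are
connected and pairwise disjoint, and each edge xy provides a lattice edge
between the blobs of x and y ([walk_model_card]): the graph is a minor of the
square lattice.

From the lattice to counting ([grid_model_card]).  Draw the lattice edges
inside blobs and one link per edge of the graph, and call two unit squares
equivalent when they cannot be separated by the drawn edges.  The links that
have a given class on exactly one side form an edge set of the graph that is
even at each vertex.  Conversely each even edge set lifts to a lattice cycle,
because blobs are connected, and a lattice cycle is the boundary of a set of
squares ([cycle_is_coboundary]); so the even edge sets are spanned by the
boundaries of the classes.

Counting ([bipartite_face_count], in the spirit of the planarity criterion of
MacLane).  The even edge sets form a space of dimension at least |E| - |V|, so
at least |E| - |V| classes have a nonempty boundary.  Each edge lies in at most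
two boundaries, and in a bipartite graph a nonempty even set has at least four
edges.  Hence 4(|E| - |V|) <= 2|E|, that is |E| <= 2|V|. *)

(** * Orientations of bounded indegree *)

Lemma eq_set2 (T : finType) (x y u v : T) : [set x; y] = [set u; v] ->
  (x = u /\ y = v) \/ (x = v /\ y = u).
Proof.
move=> e; have /set2P xuv : x \in [set u; v] by rewrite -e set21.
have /set2P yuv : y \in [set u; v] by rewrite -e set22.
have /set2P uxy : u \in [set x; y] by rewrite e set21.
have /set2P vxy : v \in [set x; y] by rewrite e set22.
case: xuv => xe; subst x; [left|right]; split=> //.
  by case: vxy => [ve|//]; subst v; case: yuv.
by case: uxy => [ue|//]; subst u; case: yuv.
Qed.

Section BoundedIndegree.
Variable G : sgraph.
Implicit Types (u v w x : G) (A : {set G * G}) (R X : {set G}).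

Lemma orientation_adj A u v : orientation A -> (u, v) \in A -> adj u v.
Proof.
by move/forallP/(_ u)/forallP/(_ v); case: (adj u v) => // /negPf->.
Qed.

Lemma orientation_anti A u v : orientation A -> (u, v) \in A -> (v, u) \notin A.
Proof.
move=> oA uvA; have := orientation_adj oA uvA.
by move/forallP/(_ u)/forallP/(_ v): oA; rewrite uvA; case: (adj u v).
Qed.

Definition flip A u v := (v, u) |: A :\ (u, v).

Lemma flip_orientation A u v : orientation A -> (u, v) \in A ->
  orientation (flip A u v).
Proof.
move=> oA uvA; have vuA := orientation_anti oA uvA.
have auv := orientation_adj oA uvA.
have nuv : u != v by apply: contraTneq auv => ->; rewrite adj_irrefl.
apply/forallP => x; apply/forallP => y; rewrite !inE !xpair_eqE.
have [/andP[/eqP-> /eqP->]|nxy] := boolP ((x == u) && (y == v)).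
  by rewrite auv !eqxx (negPf nuv).
have [/andP[/eqP-> /eqP->]|nyx] := boolP ((x == v) && (y == u)).
  by rewrite adj_sym auv !eqxx (negPf nuv).
rewrite (andbC (y == v)) (andbC (y == u)) (negPf nxy) (negPf nyx) /=.
by move/forallP/(_ x)/forallP/(_ y): oA.
Qed.

Lemma flip_indegree A u v w : orientation A -> (u, v) \in A ->
  indegree (flip A u v) w + (w == v) = indegree A w + (w == u).
Proof.
move=> oA uvA; have vuA := orientation_anti oA uvA.
have nuv : u != v.
  by apply: contraTneq (orientation_adj oA uvA) => ->; rewrite adj_irrefl.
rewrite /indegree.
have [->|nwv] := eqVneq w v.
  rewrite eq_sym (negPf nuv) addn0 addn1 (cardsD1 u [set x | (x, v) \in A]) inE uvA.
  congr _.+1; apply: eq_card => x; rewrite !inE !xpair_eqE eqxx andbT.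
  by rewrite [v == u]eq_sym (negPf nuv) andbF.
have [->|nwu] := eqVneq w u.
  rewrite addn0 addn1 (_ : [set x | (x, u) \in flip A u v] = v |: [set x | (x, u) \in A]).
    by rewrite cardsU1 inE vuA add1n.
  apply/setP => x; rewrite !inE !xpair_eqE eqxx andbT.
  by rewrite (negPf nuv) andbF.
congr (_ + _); apply: eq_card => x; rewrite !inE !xpair_eqE.
by rewrite (negPf nwv) (negPf nwu) !andbF.
Qed.

(** The inner vertices of the path lose one incoming arc and gain another. *)
Lemma reverse_path A u p : orientation A ->
  path (fun x y => (x, y) \in A) u p -> uniq (u :: p) ->
  exists2 A', orientation A' & forall w,
    indegree A' w + (w == last u p) = indegree A w + (w == u).
Proof.
elim: p A u => [|x p IHp] A u oA; first by exists A.
move=> /= /andP[uxA pathA] /andP[nup uniqp].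
have oF := flip_orientation oA uxA.
have pathF : path (fun y z => (y, z) \in flip A u x) x p.
  have : all [predC pred1 u] (x :: p) by apply/allP => y yp; apply: contraNneq nup => <-.
  move=> nu; apply: sub_in_path nu pathA => y z /= ny nz.
  by rewrite !inE !xpair_eqE (negPf (nz : z != u)) (negPf (ny : y != u)) andbF.
have [A' oA' degA'] := IHp _ _ oF pathF uniqp.
by exists A' => // w; rewrite degA' (flip_indegree w oA uxA).
Qed.

Lemma orientation_exists : exists A : {set G * G}, orientation A.
Proof.
have [A [A1 A2 _]] := proper_orientation_on [set: G].
exists A; apply/forallP => u; apply/forallP => v; case: ifPn => auv.
  by apply: A2; rewrite ?inE.
by apply: contra auv => /A1 /and3P[].
Qed.

Lemma sum_indegree A R : \sum_(v in R) indegree A v = #|[set a in A | a.2 \in R]|.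
Proof.
rewrite -sum1_card (eq_bigl (fun a => (a.2 \in R) && (a \in A))); last first.
  by move=> a; rewrite inE andbC.
rewrite (partition_big snd (mem R)) /=; last by move=> a /andP[].
apply: eq_bigr => v vR; rewrite sum1dep_card /indegree.
rewrite -(card_imset _ (fun x y => fun (h : (x, v) = (y, v)) => congr1 fst h)).
apply: eq_card => -[x y]; rewrite inE /=; apply/imsetP/idP => [[z]|].
  by rewrite inE => zA [-> ->]; rewrite vR zA eqxx.
by move=> /andP[/andP[_ xA] /eqP yv]; exists x; rewrite ?inE -?yv.
Qed.

(** Hakimi's theorem.  Minimize the total excess of the indegrees over [k].  If
[v] has indegree larger than [k], the set [R] of the vertices from which [v]
can be reached contains no vertex of indegree smaller than [k], since reversing
a path from it to [v] would lower the excess.  All arcs that enter [R] start in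
[R], so [R] spans more than [k * #|R|] edges. *)
Theorem bounded_indegree_orientation k :
  (forall R, #|[set e in edges G | e \subset R]| <= k * #|R|) ->
  exists2 A, orientation A & forall v, indegree A v <= k.
Proof.
move=> sparse; have [A0 oA0] := orientation_exists.
pose excess A := \sum_v (indegree A v - k).
case: (arg_minnP excess oA0) => A oA minA.
exists A => // v; rewrite leqNgt; apply/negP => gtk.
pose r x y := (x, y) \in A; pose R := [set w | connect r w v].
have vR : v \in R by rewrite inE connect0.
have geR w : w \in R -> k <= indegree A w.
  rewrite inE => /connectP[p0 p0r eqv]; rewrite leqNgt; apply/negP => ltk.
  case/shortenP: p0r eqv => p pr up _ vE.
  have [A' oA' degA'] := reverse_path oA pr up.
  have nwv : w != v by apply/eqP => wv; move: ltk; rewrite wv; lia.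
  have := minA A' oA'; apply/negP; rewrite -ltnNge /excess.
  rewrite (bigD1 v) //= [X in _ < X](bigD1 v) //= -addSn leq_add //.
    have := degA' v; rewrite -vE eqxx eq_sym (negPf nwv); lia.
  apply: leq_sum => x nxv; have := degA' x; rewrite -vE (negPf nxv).
  case: eqVneq => [->|_]; lia.
have : k * #|R| < \sum_(w in R) indegree A w.
  rewrite (bigD1 v) //= (cardsD1 v) vR mulnDr muln1 -addSn leq_add //.
  rewrite mulnC -sum_nat_const (eq_bigl (fun w => (w \in R) && (w != v))).
    by apply: leq_sum => w /andP[/geR].
  by move=> w; rewrite !inE andbC.
apply/negP; rewrite -leqNgt sum_indegree; apply: leq_trans (sparse R).
have inj : {in [set a in A | a.2 \in R] &,
    injective (fun a : G * G => [set a.1; a.2])}.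
  move=> [a b] [c d]; rewrite !inE /= => /andP[abA _] /andP[cdA _].
  case/eq_set2 => -[? ?]; subst c d => //.
  by rewrite (negPf (orientation_anti oA abA)) in cdA.
rewrite -(card_in_imset inj); apply/subset_leq_card/subsetP => _ /imsetP[[a b] + ->].
rewrite !inE /= => /andP[abA bR]; apply/andP; split.
  apply/imsetP; exists (a, b) => //; rewrite inE; exact: orientation_adj abA.
rewrite subUset !sub1set inE; apply/andP; split; last by rewrite inE.
by apply: connect_trans bR; apply: connect1.
Qed.

Lemma card_between (T : finType) (B C : {set T}) k :
  B \subset C -> #|B| <= k -> k <= #|C| ->
  exists J : {set T}, [/\ B \subset J, J \subset C & #|J| = k].
Proof.
elim: k => [|k IHk] BC leB leC.
  by exists B; split=> //; apply/eqP; rewrite -leqn0.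
move: leB; rewrite leq_eqVlt => /orP[/eqP eqB|ltB]; first by exists B.
have [J [BJ JC cardJ]] := IHk BC ltB (ltnW leC).
have [x xC xJ] : exists2 x, x \in C & x \notin J.
  apply/subsetPn; apply: contraTN leC => /subset_leq_card.
  by rewrite cardJ ltnNge => ->.
exists (x |: J); split; last by rewrite cardsU1 xJ cardJ.
  by apply: subset_trans BJ _; apply: subsetUr.
by rewrite subUset sub1set xC.
Qed.

Lemma min_degree_le v : min_degree G <= degree v.
Proof.
rewrite /min_degree; have: v \in index_enum G by rewrite mem_index_enum.
elim: (index_enum G) => // w s IHs; rewrite inE big_cons geq_min.
by case/orP=> [/eqP->|/IHs ->]; rewrite ?leqnn ?orbT.
Qed.

(** [J x] is the set of the in-neighbours of a vertex [x] of [X] after the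
reversals; it extends the given one, so that indegrees outside [X] can only
decrease. *)
Lemma saturate_side k X A : (forall u v, adj u v -> (u \in X) != (v \in X)) ->
  orientation A -> (forall v, indegree A v <= k) -> k < min_degree G ->
  has_proper_k_orientation G k.+1.
Proof.
move=> bipX oA lek ltk.
have /choice[J JP] : forall x, exists J : {set G},
    [/\ [set u | (u, x) \in A] \subset J, J \subset [set u | adj u x]
        & #|J| = k.+1].
  move=> x; have gtk : k < #|[set u | adj u x]| := leq_trans ltk (min_degree_le x).
  apply: (card_between _ (leqW (lek x) : #|[set u | (u, x) \in A]| <= k.+1) gtk).
  by apply/subsetP => u; rewrite !inE => /(orientation_adj oA).
pose B := [set a : G * G | if a.2 \in X then a.1 \in J a.2
                           else adj a.1 a.2 && (a.2 \notin J a.1)].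
have BX x : x \in X -> indegree B x = k.+1.
  by move=> xX; have [_ _ <-] := JP x; apply: eq_card => u; rewrite !inE /= xX.
have BY y : y \notin X -> indegree B y <= k.
  move=> yX; apply: leq_trans (lek y); apply/subset_leq_card/subsetP => u.
  rewrite !inE /= (negPf yX) => /andP[auy nJ].
  have [/subsetP/(_ y) AJ _ _] := JP u; rewrite inE in AJ.
  move/forallP/(_ u)/forallP/(_ y): oA; rewrite auy.
  by case: ((u, y) \in A) => //= yuA; rewrite AJ in nJ.
have JX x y : y \in J x -> adj y x.
  by have [_ /subsetP/(_ y) + _] := JP x; rewrite inE => h /h.
apply/existsP; exists B; apply/and3P; split.
- apply/forallP => u; apply/forallP => v; rewrite !inE /=.
  case: ifPn => auv; last first.
    case: (v \in X); last by rewrite (negPf auv).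
    by apply: contra auv => /JX.
  have := bipX _ _ auv; rewrite (adj_sym v u) auv.
  by case: (u \in X); case: (v \in X) => //= _; case: (_ \in J _).
- apply/forallP => v; case: (boolP (v \in X)) => [/BX->//|/BY/leqW//].
- apply/forallP => u; apply/forallP => v; apply/implyP => /bipX.
  case: (boolP (u \in X)) => uX; case: (boolP (v \in X)) => vX // _.
    by rewrite (BX u uX) neq_ltn ltnS (BY v vX) orbT.
  by rewrite (BX v vX) neq_ltn ltnS (BY u uX).
Qed.

End BoundedIndegree.

(** * Even edge sets of a bipartite graph *)

Lemma xor_pick (T : finType) (P : pred T) (x : T) :
  \big[addb/false]_i (P i && (x == i)) = P x.
Proof.
rewrite (bigD1 x) //= eqxx andbT big1 ?addbF // => i.
by rewrite eq_sym => /negPf->; rewrite andbF.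
Qed.

Section CycleSpace.
Variables (U W : finType).
Implicit Types (e : U * W) (v : U + W) (S : {set U * W}).

(** A bipartite graph is a set of pairs, its two sides being kept apart by the
sum type [U + W] of vertices. *)
Definition incident e v : bool :=
  match v with inl x => x == e.1 | inr y => y == e.2 end.

Definition odd_at S v : bool :=
  \big[addb/false]_e ((e \in S) && incident e v).

Definition even_set S : Prop := forall v, odd_at S v = false.

Definition symdiff S S' : {set U * W} := [set e | (e \in S) (+) (e \in S')].

Lemma odd_at_symdiff S S' v :
  odd_at (symdiff S S') v = odd_at S v (+) odd_at S' v.
Proof.
rewrite /odd_at -big_split /=; apply: eq_bigr => e _.
by rewrite inE andb_addl.
Qed.

Lemma even_set_other_edge S e v : even_set S -> e \in S -> incident e v ->
  exists e', [/\ e' \in S, incident e' v & e' != e].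
Proof.
move=> evS eS ev; move: (evS v); rewrite /odd_at (bigD1 e) //= eS ev /=.
move/negbFE => rest.
case: (boolP [exists e', [&& e' \in S, incident e' v & e' != e]]).
  by case/existsP=> e' /and3P[]; exists e'.
move/existsPn => none; move: rest; rewrite big1 // => e' ne'.
by apply/negbTE/negP => /andP[h1 h2]; move: (none e'); rewrite h1 h2 ne'.
Qed.

(** Starting from an edge, leave both of its ends by other edges, and then the
far end of one of these by a fourth edge.  The graph is bipartite and simple, so
these edges are distinct, also when they close up to a cycle. *)
Lemma even_set_card S : even_set S -> S != set0 -> 4 <= #|S|.
Proof.
move=> evS /set0Pn[[x0 y0] e0].
have [[u1 y1] [e1 /= /eqP h1 n1]] :=
  even_set_other_edge (v := inl x0) evS e0 (eqxx _).
have [[x1 w2] [e2 /= /eqP h2 n2]] :=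
  even_set_other_edge (v := inr y0) evS e0 (eqxx _).
subst u1 w2.
have [[u3 y2] [e3 /= /eqP h3 n3]] :=
  even_set_other_edge (v := inl x1) evS e2 (eqxx _).
subst u3.
have us : uniq [:: (x0, y0); (x0, y1); (x1, y0); (x1, y2)].
  have {}n1 : y1 != y0 by apply: contra n1 => /eqP->.
  have {}n2 : x1 != x0 by apply: contra n2 => /eqP->.
  have {}n3 : y2 != y0 by apply: contra n3 => /eqP->.
  rewrite /= !inE !xpair_eqE !eqxx /= (eq_sym x0) (negPf n2).
  by rewrite (eq_sym y0 y1) (negPf n1) (eq_sym y0) (negPf n3).
have -> : 4 = #|[:: (x0, y0); (x0, y1); (x1, y0); (x1, y2)]|.
  by rewrite (card_uniqP us).
apply/subset_leq_card/subsetP => e.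
by rewrite !inE => /or4P[] /eqP->.
Qed.

(** Rank-nullity for the boundary map, which sends an edge set to the set of
its vertices of odd degree: a nonempty fibre is a translate of the kernel. *)
Lemma card_even_sets (E : {set U * W}) (R : {set U + W}) (Z : {set {set U * W}}) :
  (forall e, e \in E -> inl e.1 \in R /\ inr e.2 \in R) ->
  (forall S, S \subset E -> even_set S -> S \in Z) ->
  2 ^ #|E| <= 2 ^ #|R| * #|Z|.
Proof.
move=> ER EZ; pose bnd S := [set v | odd_at S v].
have bndR S : S \in powerset E -> bnd S \in powerset R.
  rewrite !inE => /subsetP SE; apply/subsetP => v; rewrite inE; apply: contraTT => vR.
  rewrite /odd_at big1 // => e _; apply/negbTE/negP => /andP[/SE/ER[]].
  by case: v vR => x vR R1 R2 /= /eqP xe; rewrite xe ?R1 ?R2 in vR.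
rewrite -!card_powerset -sum1_card (partition_big bnd (mem (powerset R))) //=.
rewrite -sum_nat_const; apply: leq_sum => T _; rewrite sum1dep_card.
have [->|/set0Pn[S0]] := eqVneq [set S | (S \in powerset E) && (bnd S == T)] set0.
  by rewrite cards0.
rewrite !inE => /andP[S0E /eqP bS0].
have inj : injective (symdiff S0).
  move=> S S' /setP eqS; apply/setP => e; move: (eqS e); rewrite !inE.
  exact: addbI.
rewrite -(card_imset _ inj); apply/subset_leq_card/subsetP => _ /imsetP[S + ->].
rewrite !inE => /andP[SE /eqP bS]; apply: EZ => [|v].
  apply/subsetP => e; rewrite inE.
  by case: (boolP (e \in S0)) => [/(subsetP S0E)//|_ /(subsetP SE)].
rewrite odd_at_symdiff; have /setP/(_ v) : bnd S0 = bnd S by rewrite bS.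
by rewrite !inE => ->; rewrite addbb.
Qed.

(** Here [I] is a set of faces, and [a e], [b e] are the faces on the two
sides of [e].  No topology is involved: all that is asked of the faces is that
their boundaries are even and span the even sets. *)
Lemma bipartite_face_count (E : {set U * W}) (R : {set U + W}) (I : finType)
    (a b : U * W -> I) :
  (forall e, e \in E -> inl e.1 \in R /\ inr e.2 \in R) ->
  (forall i, even_set [set e in E | (a e == i) (+) (b e == i)]) ->
  (forall S, S \subset E -> even_set S -> exists c : I -> bool,
     forall e, e \in E -> (e \in S) = c (a e) (+) c (b e)) ->
  #|E| <= 2 * #|R|.
Proof.
move=> ER faceE faceZ.
pose bd i := [set e in E | (a e == i) (+) (b e == i)].
pose J := [set i | bd i != set0].
pose Phi (A : {set I}) := [set e in E | \big[addb/false]_(i in A) (e \in bd i)].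
(* Each even set is a sum of nonempty boundaries. *)
have leEJ : #|E| <= #|R| + #|J|.
  rewrite -(leq_exp2l (m := 2)) // expnD -(card_powerset J).
  have := card_even_sets ER (Z := Phi @: powerset J).
  move=> H; apply: leq_trans (H _) _; last first.
    by rewrite leq_mul2l leq_imset_card orbT.
  move=> S SE evS; have [c cP] := faceZ S SE evS.
  apply/imsetP; exists [set i in J | c i].
    by rewrite inE; apply/subsetP => i; rewrite inE => /andP[].
  apply/setP => e; rewrite inE; case: (boolP (e \in E)) => [eE|]; last first.
    by apply: contraNF => /(subsetP SE).
  rewrite cP //= -(xor_pick c (a e)) -(xor_pick c (b e)) -big_split /=.
  rewrite [RHS]big_mkcond /=; apply: eq_bigr => i _.
  rewrite !inE eE /= -andb_addr; case: (boolP (bd i != set0)) => [_|].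
    by case: (c i).
  rewrite negbK => /eqP/setP/(_ e); rewrite !inE eE /= => ->.
  by rewrite andbF.
(* Double counting of the pairs formed by a face and an edge of its boundary. *)
have le4 : 4 * #|J| <= 2 * #|E|.
  rewrite mulnC -sum_nat_const.
  apply: (@leq_trans (\sum_(i in J) #|bd i|)).
    by apply: leq_sum => i; rewrite inE => /even_set_card; apply; apply: faceE.
  apply: (@leq_trans (\sum_i #|bd i|)).
    by rewrite [X in _ <= X](bigID (mem J)) leq_addr.
  under eq_bigr do rewrite -sum1_card big_mkcond /=.
  rewrite exchange_big /= (bigID (mem E)) /= [X in _ + X]big1 ?addn0; last first.
    by move=> e neE; apply: big1 => i _; rewrite inE (negPf neE).
  rewrite mulnC -sum_nat_const; apply: leq_sum => e eE.
  apply: (@leq_trans (\sum_i ((a e == i) + (b e == i)))).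
    by apply: leq_sum => i _; rewrite inE eE /=; case: (_ == _); case: (_ == _).
  rewrite big_split /=.
  have s1 x : \sum_(i : I) (x == i) = 1.
    rewrite (bigD1 x) //= eqxx big1 // => i; rewrite eq_sym => /negPf-> //.
  by rewrite !s1.
lia.
Qed.

End CycleSpace.

(** * Chains in the square lattice *)

(** The lattice edge [(true, (i, j))] joins [(i, j)] to [(i.+1, j)] and
[(false, (i, j))] joins [(i, j)] to [(i, j.+1)].  Unit squares are also named
by pairs: square [(i, j)] has the point [(i, j)] as its upper right corner, so
the four squares around this point are [(i, j)], [(i.+1, j)], [(i, j.+1)] and
[(i.+1, j.+1)]. *)
Local Notation node := (nat * nat)%type.
Local Notation grid_edge := (bool * (nat * nat))%type.

Section Grid.
Implicit Types (p : node) (q : grid_edge).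

Definition src q : node := q.2.
Definition tgt q : node := if q.1 then (q.2.1.+1, q.2.2) else (q.2.1, q.2.2.+1).

(** The squares on the two sides of [q].  One of them has the same name as the
target of [q], an accident of the naming of squares. *)
Definition lface q : node := tgt q.
Definition rface q : node := (q.2.1.+1, q.2.2.+1).

Implicit Types (ch : grid_edge -> bool) (c : node -> bool).

(** Values on the edges that arrive at [(i, j)] from the left and from below;
no edge arrives from outside the quadrant. *)
Definition horiz ch i j := if i is i'.+1 then ch (true, (i', j)) else false.
Definition vert ch i j := if j is j'.+1 then ch (false, (i, j')) else false.

Definition odd_deg ch p : bool :=
  (horiz ch p.1 p.2 (+) horiz ch p.1.+1 p.2)
  (+) (vert ch p.1 p.2 (+) vert ch p.1 p.2.+1).

Definition coboundary c q := c (lface q) (+) c (rface q).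

Lemma odd_deg_add ch ch' p :
  odd_deg (fun q => ch q (+) ch' q) p = odd_deg ch p (+) odd_deg ch' p.
Proof.
rewrite /odd_deg; case: p => i j /=.
have -> : horiz (fun q => ch q (+) ch' q) i j = horiz ch i j (+) horiz ch' i j.
  by case: i.
have -> : vert (fun q => ch q (+) ch' q) i j = vert ch i j (+) vert ch' i j.
  by case: j.
rewrite (addbACA (horiz ch i j)) (addbACA (vert ch i j)).
exact: addbACA.
Qed.

Lemma odd_deg0 p : odd_deg (fun=> false) p = false.
Proof. by case: p => [[|i] [|j]]. Qed.

Lemma odd_deg_sum (T : finType) (P : pred T) (F : T -> grid_edge -> bool) p :
  odd_deg (fun q => \big[addb/false]_(t | P t) F t q) p
  = \big[addb/false]_(t | P t) odd_deg (F t) p.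
Proof.
rewrite /odd_deg !big_split /=.
by congr (_ (+) _ (+) (_ (+) _)); case: p => [[|i] [|j]] //=; rewrite big1.
Qed.

Lemma odd_deg_edge q p : odd_deg (pred1 q) p = (p == src q) (+) (p == tgt q).
Proof.
case: q => [[] [k l]]; case: p => [[|i] [|j]];
  rewrite /odd_deg /src /tgt /= !xpair_eqE ?eqE /= ?eqSS.
all: rewrite ?addbF ?addFb ?andbF //=.
all: by rewrite addbC // eq_sym.
Qed.

(** The quadrant has no holes.  A square belongs to the filling when the ray
leaving it to the left crosses the cycle an odd number of times; evenness at
the lattice points makes this consistent with vertical moves. *)
Lemma cycle_is_coboundary ch : (forall p, odd_deg ch p = false) ->
  exists c, forall q, ch q = coboundary c q.
Proof.
move=> ev; pose c p := \big[addb/false]_(0 <= k < p.1) vert ch k p.2.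
have cV i j : vert ch i j = c (i, j) (+) c (i.+1, j).
  by rewrite /c /= big_nat_recr //= addKb.
have c0 j : c (0, j) = false by rewrite /c big_geq.
clearbody c.
have cH i j : horiz ch i j = c (i, j) (+) c (i, j.+1).
  elim: i => [|i IHi]; first by rewrite !c0.
  have : (horiz ch i j (+) horiz ch i.+1 j)
    (+) (vert ch i j (+) vert ch i j.+1) = false := ev (i, j).
  rewrite IHi !cV; case: (horiz ch i.+1 j); case: (c (i, j));
    case: (c (i, j.+1)); case: (c (i.+1, j)); by case: (c (i.+1, j.+1)).
exists c => -[[] [i j]]; rewrite /coboundary /lface /rface /tgt /=.
  exact: (cH i.+1 j).
exact: (cV i j.+1).
Qed.

(** Around a point, the colour of the four squares changes an even number of
times. *)
Lemma coboundary_even c i j : odd_deg (coboundary c) (i.+1, j.+1) = false.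
Proof.
rewrite /odd_deg /coboundary /lface /rface /tgt /=.
by case: (c (i.+1, j.+1)); case: (c (i.+2, j.+1)); case: (c (i.+1, j.+2));
   case: (c (i.+2, j.+2)).
Qed.

Lemma xor_by_parts (b h : nat -> bool) n : b 0 = false -> b n = false ->
  \big[addb/false]_(i < n) (b i && (h i (+) h i.+1))
  = \big[addb/false]_(i < n) (h i.+1 && (b i (+) b i.+1)).
Proof.
move=> b0 bn; suff parts m : \big[addb/false]_(i < m) (b i && (h i (+) h i.+1))
    (+) (b m && h m) = \big[addb/false]_(i < m) (h i.+1 && (b i (+) b i.+1)).
  by rewrite -parts bn addbF.
elim: m => [|m IHm]; first by rewrite !big_ord0 b0.
rewrite !big_ord_recr /= -IHm; move: (\big[_/_]_(i < m) _) => s.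
by case: s; case: (b m); case: (b m.+1); case: (h m); case: (h m.+1).
Qed.

Definition box_edge n (t : bool * ('I_n * 'I_n)) : grid_edge :=
  (t.1, (nat_of_ord t.2.1, nat_of_ord t.2.2)).

(** Summing the degrees over a region counts the edges inside twice and the
edges that leave it once. *)
Lemma cut_parity (b : node -> bool) n ch :
  (forall p, b p -> [&& 0 < p.1 < n & 0 < p.2 < n]) ->
  \big[addb/false]_(t : bool * ('I_n * 'I_n))
     (ch (box_edge t) && (b (src (box_edge t)) (+) b (tgt (box_edge t))))
  = \big[addb/false]_(s : 'I_n * 'I_n)
     (b (nat_of_ord s.1, nat_of_ord s.2) &&
        odd_deg ch (nat_of_ord s.1, nat_of_ord s.2)).
Proof.
move=> bn.
have b0 p : [|| p.1 == 0, p.2 == 0, p.1 == n | p.2 == n] -> b p = false.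
  by move=> h; apply/negbTE/negP => /bn; lia.
under [RHS]eq_bigr do rewrite /odd_deg andb_addr.
rewrite big_split /= -(pair_bigA _ (fun i j : 'I_n => b (val i, val j) &&
   (horiz ch i j (+) horiz ch i.+1 j))) exchange_big /=.
rewrite -(pair_bigA _ (fun i j : 'I_n => b (val i, val j) &&
   (vert ch i j (+) vert ch i j.+1))) /=.
rewrite -(pair_bigA _ (fun d (s : 'I_n * 'I_n) =>
   ch (box_edge (d, s)) && (b (src (box_edge (d, s))) (+) b (tgt (box_edge (d, s)))))).
rewrite big_bool /=; congr (_ (+) _).
  rewrite -(pair_bigA _ (fun i j : 'I_n => ch (true, (val i, val j)) &&
    (b (val i, val j) (+) b (i.+1, val j)))) exchange_big /=.
  apply: eq_bigr => j _.
  rewrite (@xor_by_parts (fun i => b (i, val j)) (fun i => horiz ch i j)) //=.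
    by rewrite b0 ?eqxx ?orbT.
  by rewrite b0 ?eqxx ?orbT.
rewrite -(pair_bigA _ (fun i j : 'I_n => ch (false, (val i, val j)) &&
    (b (val i, val j) (+) b (val i, j.+1)))) /=.
apply: eq_bigr => i _.
rewrite (@xor_by_parts (fun j => b (val i, j)) (fun j => vert ch i j)) //=.
  by rewrite b0 ?eqxx ?orbT.
by rewrite b0 ?eqxx ?orbT.
Qed.

End Grid.

(** * Graphs drawn in the lattice *)

(** Connectivity in the form in which it is used: a chain in [B] whose odd
points are [p] and [r], instead of a path. *)
Definition linked (B : node -> bool) (p r : node) : Prop :=
  exists ch : grid_edge -> bool,
  (forall q, ch q -> B (src q) && B (tgt q)) /\
  (forall s, odd_deg ch s = (s == p) (+) (s == r)).

Section GridModel.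
Variables (U W : finType) (E : {set U * W}) (R : {set U + W}).
Variables (lab : node -> option (U + W)) (root : U + W -> node).
Variables (link : U * W -> grid_edge) (n : nat).
Implicit Types (p r : node) (q : grid_edge).
Implicit Types (e : U * W) (v : U + W) (S : {set U * W}).

Hypothesis ER : forall e, e \in E -> inl e.1 \in R /\ inr e.2 \in R.
Hypothesis lab_box : forall p, lab p -> [&& 0 < p.1 < n & 0 < p.2 < n].
Hypothesis lab_linked : forall v p, lab p = Some v ->
  linked (fun r => lab r == Some v) (root v) p.
Hypothesis link_ends : forall e, e \in E ->
  (lab (src (link e)) = Some (inl e.1) /\ lab (tgt (link e)) = Some (inr e.2)) \/
  (lab (src (link e)) = Some (inr e.2) /\ lab (tgt (link e)) = Some (inl e.1)).

Definition drawn q : bool :=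
  (lab (src q) == lab (tgt q)) && (lab (src q) : bool) || [exists e in E, link e == q].

(** Squares in the same component of the complement of the drawn edges,
expressed through the functions that are constant on components. *)
Definition same_face p r : Prop := forall c : node -> bool,
  (forall q, ~~ drawn q -> c (lface q) = c (rface q)) -> c p = c r.

Definition side_pixel (s : (U * W) * bool) : node :=
  if s.2 then lface (link s.1) else rface (link s.1).

(** The component of a square, coded as a finite object: it is remembered only
through the sides of the links that it contains. *)
Definition face p : {set (U * W) * bool} :=
  [set s | `[< same_face p (side_pixel s) >]].

Lemma link_inj : {in E &, injective link}.
Proof.
move=> [x y] [x' y'] /link_ends /= h /link_ends /= h' eqq; rewrite eqq in h.
by case: h => -[-> ->] in h'; case: h' => -[] // [->] [->].
Qed.

Lemma link_drawn e : e \in E -> drawn (link e).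
Proof. by move=> eE; apply/orP; right; apply/exists_inP; exists e. Qed.

Lemma link_not_inside e v : e \in E ->
  (lab (src (link e)) == Some v) && (lab (tgt (link e)) == Some v) = false.
Proof. by case/link_ends => -[-> ->]; case: v => w; rewrite ?andbF. Qed.

Lemma face_crossing p r : same_face p r -> face p = face r.
Proof.
move=> pr; apply/setP => s; rewrite !inE; apply/asboolP/asboolP => h c cc.
  by rewrite -(pr c cc); apply: h.
by rewrite (pr c cc); apply: h.
Qed.

Lemma undrawn_face q : ~~ drawn q -> face (lface q) = face (rface q).
Proof. by move=> nq; apply: face_crossing => c; apply. Qed.

(** The boundary of a component is even at every lattice point off the border
and consists of drawn edges.  Summed over the blob of [v], this says that the
boundary contains an even number of the links that leave the blob. *)
Lemma face_boundary_even i : even_set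
  [set e in E | (face (lface (link e)) == i) (+) (face (rface (link e)) == i)].
Proof.
move=> v; pose c p := face p == i; pose b p := lab p == Some v.
pose A e := [&& e \in E, coboundary c (link e) & incident e v].
have chD q : coboundary c q -> drawn q.
  by apply: contraTT => /undrawn_face; rewrite /coboundary /c => ->; rewrite addbb.
have bbox p : b p -> [&& 0 < p.1 < n & 0 < p.2 < n].
  by move=> /eqP bp; apply: lab_box; rewrite bp.
have cutE q : coboundary c q && (b (src q) (+) b (tgt q))
    = \big[addb/false]_e (A e && (link e == q)).
  case: (boolP [exists e in E, link e == q]) => [/exists_inP[e eE /eqP <-]|].
    rewrite (bigD1 e) //= eqxx andbT big1 ?addbF => [|e' ne].
      rewrite /A eE /=; congr (_ && _).
      rewrite /b; case/link_ends: eE => -[-> ->]; case: (v) => w /=;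
        by rewrite ?addbF ?addFb eq_sym.
    apply/negbTE/negP => /andP[/and3P[e'E _ _] /eqP/link_inj ee].
    by rewrite ee ?eqxx in ne.
  move=> /negbTE nE; rewrite big1 => [|e _].
    apply/negbTE/negP => /andP[/chD]; rewrite /drawn nE orbF => /andP[/eqP lq _].
    by rewrite /b lq addbb.
  apply/negbTE/negP => /andP[/and3P[eE _ _] /eqP qe].
  by move/negbT/exists_inPn: nE => /(_ e eE); rewrite qe eqxx.
have := cut_parity (coboundary c) bbox.
rewrite [RHS]big1 => [<-|[k l] _]; last first.
  apply/negbTE/negP => /andP[/bbox/= ]; case: (nat_of_ord k) => // k'.
  by case: (nat_of_ord l) => [|l']; rewrite ?andbF // coboundary_even.
under [RHS]eq_bigr do rewrite cutE.
rewrite exchange_big /=; apply: eq_bigr => e _; rewrite !inE.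
transitivity (A e); first by rewrite /A /coboundary andbA.
case: (boolP (A e)) => [/and3P[eE _ _]|_]; last by rewrite big1.
have [t eq_link] : exists t : bool * ('I_n * 'I_n), link e = box_edge t.
  have : lab (src (link e)) by case/link_ends: eE => -[->].
  move/lab_box; rewrite /src; case: (link e) => d [k l] /=.
  move=> /andP[/andP[_ kn] /andP[_ ln]].
  by exists (d, (Ordinal kn, Ordinal ln)).
rewrite (bigD1 t) //= eq_link eqxx big1 ?addbF // => -[d [k l]] ne.
apply: contraNF ne => /eqP; rewrite /box_edge; case: (t) => d' [k' l'] /=.
by case=> -> /val_inj-> /val_inj->.
Qed.

(** Inside the two blobs joined by a link, extend the link to a chain between
the roots of the blobs.  Over an even set of edges these chains add up to a
cycle, and the filling of this cycle is a union of components. *)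
Lemma even_set_face_sum S : S \subset E -> even_set S -> exists c : _ -> bool,
  forall e, e \in E ->
    (e \in S) = c (face (lface (link e))) (+) c (face (rface (link e))).
Proof.
move=> SE evS.
have /choice[L LP] : forall e, exists ch : grid_edge -> bool, e \in E ->
    [/\ forall q, ch q -> drawn q,
        forall e', e' \in E -> ch (link e') = (e' == e)
      & forall s, odd_deg ch s = (s == root (inl e.1)) (+) (s == root (inr e.2))].
  move=> e; case: (boolP (e \in E)) => [eE|_]; last by exists (fun=> false).
  have [x [y [labx laby xy]]] : exists x y, [/\ lab x = Some (inl e.1),
      lab y = Some (inr e.2) & forall s,
      (s == src (link e)) (+) (s == tgt (link e)) = (s == x) (+) (s == y)].
    case: (link_ends eE) => -[h1 h2].
      by exists (src (link e)), (tgt (link e)).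
    by exists (tgt (link e)), (src (link e)); split=> // s; rewrite addbC.
  have [ch1 [in1 deg1]] := lab_linked labx.
  have [ch2 [in2 deg2]] := lab_linked laby.
  exists (fun q => ch1 q (+) ch2 q (+) pred1 (link e) q) => _; split.
  - move=> q; case: (boolP (ch1 q)) => [/in1/andP[/eqP h1 /eqP h2] _|_].
      by rewrite /drawn h1 h2 eqxx.
    case: (boolP (ch2 q)) => [/in2/andP[/eqP h1 /eqP h2] _|_ /eqP->].
      by rewrite /drawn h1 h2 eqxx.
    exact: link_drawn.
  - move=> e' e'E /=.
    have -> : ch1 (link e') = false.
      by apply/negbTE/negP => /in1; rewrite link_not_inside.
    have -> : ch2 (link e') = false.
      by apply/negbTE/negP => /in2; rewrite link_not_inside.
    by apply/eqP/eqP => [/link_inj->|->].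
  - move=> s; rewrite !odd_deg_add odd_deg_edge deg1 deg2 xy.
    by do 4!case: (s == _).
pose total q := \big[addb/false]_(e in S) L e q.
have [c cP] : exists c, forall q, total q = coboundary c q.
  apply: cycle_is_coboundary => s; rewrite odd_deg_sum.
  rewrite (eq_bigr (fun e => (s == root (inl e.1)) (+) (s == root (inr e.2)))).
    rewrite big_split /= !(big_mkcond (mem S)) /=.
    have sumv (g : U * W -> U + W) (T : finType) (h : T -> U + W) (k : U * W -> T) :
        (forall e, h (k e) = g e) -> (forall t e, incident e (h t) = (t == k e)) ->
        \big[addb/false]_e (if e \in S then s == root (g e) else false) = false.
      move=> hk inch.
      transitivity (\big[addb/false]_e \big[addb/false]_t
          ((s == root (h t)) && ((e \in S) && incident e (h t)))).
        apply: eq_bigr => e _; rewrite -hk.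
        case: (e \in S); last by rewrite big1 // => t _; rewrite andbF.
        rewrite -(xor_pick (fun t => s == root (h t))).
        by apply: eq_bigr => t _; rewrite inch (eq_sym t).
      rewrite exchange_big big1 // => t _.
      by rewrite -big_distrr /= [X in _ && X](evS (h t)) andbF.
    rewrite (sumv _ U inl fst) ?(sumv _ W inr snd) //.
  by move=> e /(subsetP SE)/LP[].
exists (fun i : {set _} => [exists s in i, c (side_pixel s)]) => e eE.
have c_face s : [exists s' in face (side_pixel s), c (side_pixel s')]
    = c (side_pixel s).
  have cc q : ~~ drawn q -> c (lface q) = c (rface q).
    move=> nq; have : total q = false.
      rewrite /total big1 // => e' /(subsetP SE)/LP[dr _ _].
      by apply/negbTE; apply: contra nq; apply: dr.
    by rewrite cP /coboundary; case: (c _); case: (c _).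
  apply/exists_inP/idP => [[s']|cs].
    by rewrite inE => /asboolP/(_ c cc) ->.
  by exists s => //; rewrite inE; apply/asboolP.
rewrite (c_face (e, true)) (c_face (e, false)) /side_pixel /= -[RHS]/(coboundary c _).
rewrite -cP /total; case: (boolP (e \in S)) => eS.
  rewrite (bigD1 e) //=; have [_ -> // _] := LP e eE; rewrite eqxx big1 // => e'.
  by case/andP=> /(subsetP SE)/LP[_ h _]; rewrite h // eq_sym => /negPf.
rewrite big1 // => e' e'S; have [_ -> // _] := LP e' (subsetP SE e' e'S).
by apply/eqP => ee; rewrite ee e'S in eS.
Qed.

Theorem grid_model_card : #|E| <= 2 * #|R|.
Proof.
exact: bipartite_face_count ER face_boundary_even even_set_face_sum.
Qed.

End GridModel.

(** * Graphs traced by walks in the lattice *)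

Section Walks.
Implicit Types (p r : node) (B : node -> bool).

Definition grid_adj p r : Prop := exists q,
  (src q = p /\ tgt q = r) \/ (src q = r /\ tgt q = p).

Lemma linked_refl B p : linked B p p.
Proof. by exists (fun=> false); split=> // s; rewrite odd_deg0 addbb. Qed.

Lemma linked_sym B p r : linked B p r -> linked B r p.
Proof.
by case=> ch [chB dch]; exists ch; split=> // s; rewrite dch addbC.
Qed.

Lemma linked_trans B p r t : linked B p r -> linked B r t -> linked B p t.
Proof.
move=> [c1 [B1 d1]] [c2 [B2 d2]]; exists (fun q => c1 q (+) c2 q); split=> [q|s].
  by case: (boolP (c1 q)) => [/B1//|_ /B2].
by rewrite odd_deg_add d1 d2 -addbA addKb.
Qed.

Lemma linked_adj B p r : B p -> B r -> grid_adj p r -> linked B p r.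
Proof.
move=> Bp Br [q qpr]; exists (pred1 q); split=> [_ /eqP->|s].
  by case: qpr => -[-> ->]; rewrite Bp Br.
by rewrite odd_deg_edge; case: qpr => -[-> ->] //; rewrite addbC.
Qed.

Lemma linked_walk B (f : nat -> node) a b : a <= b ->
  (forall j, a <= j < b -> f j = f j.+1 \/ grid_adj (f j) (f j.+1)) ->
  (forall j, a <= j <= b -> B (f j)) -> linked B (f a) (f b).
Proof.
move=> ab step inB; rewrite -(subnKC ab); have : a + (b - a) <= b by rewrite subnKC.
elim: (b - a) => [|k IHk] kb; first by rewrite addn0; apply: linked_refl.
apply: linked_trans (IHk _) _; first lia.
rewrite addnS; case: (step (a + k)) => [|->|adj]; first lia; first exact: linked_refl.
by apply: linked_adj adj; apply: inB; lia.
Qed.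

End Walks.

(** Each edge [e] is traced by a walk [g e 0, ..., g e K] from its left end to
its right end, cut into a head, before index [N], and a tail.  Walks may repeat
points and walks of different edges may meet, as long as the heads of edges
with different left ends, the tails of edges with different right ends, and
heads and tails of edges with different right ends stay apart, and all starting
points stay away from all tails. *)
Section WalkModel.
Variables (U W : finType) (E : {set U * W}) (R : {set U + W}).
Variables (g : U * W -> nat -> node) (n N K : nat).
Implicit Types (e : U * W) (v : U + W) (p : node).

Hypothesis ER : forall e, e \in E -> inl e.1 \in R /\ inr e.2 \in R.
Hypothesis NK : N <= K.
Hypothesis g_box : forall e m, e \in E -> m <= K ->
  [&& 0 < (g e m).1 < n & 0 < (g e m).2 < n].
Hypothesis g_step : forall e m, e \in E -> m < K ->
  g e m = g e m.+1 \/ grid_adj (g e m) (g e m.+1).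
Hypothesis g_start : forall e e', e \in E -> e' \in E -> e.1 = e'.1 ->
  g e 0 = g e' 0.
Hypothesis g_stop : forall e e', e \in E -> e' \in E -> e.2 = e'.2 ->
  g e K = g e' K.
Hypothesis heads_disjoint : forall e e' m m', e \in E -> e' \in E ->
  e.1 != e'.1 -> m < N -> m' < N -> g e m <> g e' m'.
Hypothesis tails_disjoint : forall e e' m m', e \in E -> e' \in E ->
  e.2 != e'.2 -> N <= m <= K -> N <= m' <= K -> g e m <> g e' m'.
Hypothesis head_tail_disjoint : forall e e' m m', e \in E -> e' \in E ->
  e.2 != e'.2 -> m < N -> N <= m' <= K -> g e m <> g e' m'.
Hypothesis start_tail_disjoint : forall e e' m', e \in E -> e' \in E ->
  N <= m' <= K -> g e 0 <> g e' m'.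

(** The blob of a right vertex is made of the tails at it.  A head is cut
before it first enters the blob of its right end, because it may meet the tails
of other edges there. *)
Definition blob v p : Prop :=
  match v with
  | inr y => exists e m, [/\ e \in E, e.2 = y, N <= m <= K & g e m = p]
  | inl x => exists e m, [/\ e \in E, e.1 = x, g e m = p, m <= K &
      forall j e' m', j <= m -> e' \in E -> e'.2 = e.2 -> N <= m' <= K ->
        g e j <> g e' m']
  end.

Lemma blob_head e m : m <= K ->
  (forall j e' m', j <= m -> e' \in E -> e'.2 = e.2 -> N <= m' <= K ->
     g e j <> g e' m') -> e \in E -> m < N.
Proof.
move=> mK away eE; rewrite ltnNge; apply/negP => Nm.
by apply: (away m e m) => //; rewrite Nm mK.
Qed.

Lemma blob_disjoint v v' p : blob v p -> blob v' p -> v = v'.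
Proof.
case: v v' => [x|y] [x'|y'] /=.
- move=> [e [m [eE <- gp mK /blob_head hm]]] [e' [m' [e'E <- gp' m'K /blob_head hm']]].
  congr inl; apply/eqP; apply/negPn/negP => ne.
  by apply: (heads_disjoint eE e'E ne (hm mK eE) (hm' m'K e'E)); rewrite gp gp'.
- move=> [e [m [eE <- gp mK away]]] [e' [m' [e'E <- m'K gp']]]; exfalso.
  have [e2|ne] := eqVneq e.2 e'.2.
    by apply: (away m e' m') => //; rewrite gp gp'.
  by apply: (head_tail_disjoint eE e'E ne (blob_head mK away eE) m'K); rewrite gp gp'.
- move=> [e' [m' [e'E <- m'K gp']]] [e [m [eE <- gp mK away]]]; exfalso.
  have [e2|ne] := eqVneq e.2 e'.2.
    by apply: (away m e' m') => //; rewrite gp gp'.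
  by apply: (head_tail_disjoint eE e'E ne (blob_head mK away eE) m'K); rewrite gp gp'.
- move=> [e [m [eE <- mK gp]]] [e' [m' [e'E <- m'K gp']]].
  congr inr; apply/eqP; apply/negPn/negP => ne.
  by apply: (tails_disjoint eE e'E ne mK m'K); rewrite gp gp'.
Qed.

Definition blob_label p : option (U + W) := [pick v | `[< blob v p >]].

Lemma blob_labelP v p : blob_label p = Some v <-> blob v p.
Proof.
rewrite /blob_label; case: pickP => [v' /asboolP bv'|none]; split=> //.
- by case=> <-.
- by move=> bv; rewrite (blob_disjoint bv bv').
- by move/asboolP; rewrite none.
Qed.

Definition blob_root v : node :=
  match v with
  | inl x => if [pick e in E | e.1 == x] is Some e then g e 0 else (0, 0)
  | inr y => if [pick e in E | e.2 == y] is Some e then g e K else (0, 0)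
  end.

Lemma blob_linked v p : blob_label p = Some v ->
  linked (fun r => blob_label r == Some v) (blob_root v) p.
Proof.
move/blob_labelP; case: v => [x|y] /=.
- move=> [e [m [eE ex <- mK away]]].
  have -> : (if [pick e in E | e.1 == x] is Some e then g e 0 else (0, 0)) = g e 0.
    case: pickP => [e' /andP[e'E /eqP e'x]|/(_ e)]; last by rewrite eE ex eqxx.
    by apply: g_start; rewrite ?ex.
  apply: linked_walk => // j jm.
    by apply: g_step => //; lia.
  apply/eqP/blob_labelP; exists e, j; split=> //; first lia.
  by move=> i e' m' ij; apply: away; lia.
- move=> [e [m [eE ey mK <-]]].
  have -> : (if [pick e in E | e.2 == y] is Some e then g e K else (0, 0)) = g e K.
    case: pickP => [e' /andP[e'E /eqP e'y]|/(_ e)]; last by rewrite eE ey eqxx.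
    by apply: g_stop; rewrite ?ey.
  apply: linked_sym; apply: linked_walk => [|j jm|j jm]; first by case/andP: mK.
    by apply: g_step => //; lia.
  by apply/eqP/blob_labelP; exists e, j; split=> //; lia.
Qed.

Lemma blob_link e : e \in E -> exists q,
  (blob_label (src q) = Some (inl e.1) /\ blob_label (tgt q) = Some (inr e.2)) \/
  (blob_label (src q) = Some (inr e.2) /\ blob_label (tgt q) = Some (inl e.1)).
Proof.
move=> eE; pose hits k := `[< blob (inr e.2) (g e k) >].
have hitK : exists k, hits k.
  by exists K; apply/asboolP; exists e, K; rewrite NK leqnn.
case: (ex_minnP hitK) => -[|k] /asboolP hk mink.
  case: hk => e' [m' [e'E _ m'K gg]].
  by case: (start_tail_disjoint eE e'E m'K).
have kK : k < K.
  by apply: mink; apply/asboolP; exists e, K; rewrite NK leqnn.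
have awayk j : j <= k -> ~ blob (inr e.2) (g e j).
  move=> jk /asboolP/mink; lia.
have headk : blob (inl e.1) (g e k).
  exists e, k; split=> // [|j e' m' jk e'E e2 m'K gg]; first lia.
  by apply: (awayk j jk); exists e', m'.
have [gg|[q adjq]] := g_step eE kK.
  by case: (awayk k (leqnn k)); rewrite gg.
by exists q; case: adjq => -[-> ->]; [left|right]; split; apply/blob_labelP.
Qed.

Theorem walk_model_card : #|E| <= 2 * #|R|.
Proof.
have /choice[link linkP] : forall e, exists q, e \in E -> 
  (blob_label (src q) = Some (inl e.1) /\ blob_label (tgt q) = Some (inr e.2)) \/
  (blob_label (src q) = Some (inr e.2) /\ blob_label (tgt q) = Some (inl e.1)).
  move=> e; case: (boolP (e \in E)) => [/blob_link[q]|_]; first by exists q.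
  by exists (true, (0, 0)).
apply: (grid_model_card (n := n)) ER _ blob_linked linkP => p.
case eqv: (blob_label p) => [v|//] _; move/blob_labelP: eqv.
case: v => w [e [m]]; first by case=> eE _ <- mK _; apply: g_box.
by case=> eE _ /andP[_ mK] <-; apply: g_box.
Qed.

End WalkModel.

(** * Rounding curves to the lattice *)

Section Approximation.
Local Open Scope ring_scope.
Local Open Scope classical_set_scope.
Variable R : realType.
Implicit Types (e s t : R).

Lemma compact_positive (T : topologicalType) (F : T -> R) (K : set T) :
  compact K -> {within K, continuous F} -> (forall k, K k -> 0 < F k) ->
  exists2 e, 0 < e & forall k, K k -> e <= F k.
Proof.
move=> cK cF Fpos; have [K0|/set0P/negP/negPn/eqP K0] := pselect (K !=set0); last first.
  by exists 1 => // k; rewrite K0.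
have [c /set_mem Kc cmin] := compact_EVT_min K0 cK cF.
by exists (F c) => [|k Kk]; [exact: Fpos|apply: cmin; exact: mem_set].
Qed.

Lemma finite_radius (T : finType) (P : T -> R -> Prop) :
  (forall i, exists2 e, 0 < e & forall d, 0 < d -> d <= e -> P i d) ->
  exists2 e, 0 < e & forall d, 0 < d -> d <= e -> forall i, P i d.
Proof.
move=> Pe; suff [e e0 eP] : exists2 e, 0 < e &
    forall d, 0 < d -> d <= e -> forall i, i \in enum T -> P i d.
  by exists e => // d d0 de i; apply: eP; rewrite ?mem_enum.
elim: (enum T) => [|i s [e e0 IHs]]; first by exists 1.
have [e' e'0 Pi] := Pe i; exists (Num.min e e'); first by rewrite lt_min e0.
move=> d d0; rewrite le_min => /andP[de de'] j; rewrite inE => /orP[/eqP->|].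
  exact: Pi.
exact: IHs.
Qed.

(** Composition with this retraction onto the unit interval turns continuity on
the interval into continuity on the line. *)
Definition clamp t : R := Num.max 0 (Num.min 1 t).

Lemma clamp_itv t : 0 <= clamp t <= 1.
Proof. by rewrite /clamp le_max lexx /= ge_max ler01 ge_min lexx. Qed.

Lemma clamp_id t : 0 <= t <= 1 -> clamp t = t.
Proof. by move=> /andP[t0 t1]; rewrite /clamp (min_idPr t1) (max_idPr t0). Qed.

Lemma clamp_continuous : continuous clamp.
Proof.
move=> t; apply: continuous_max; first exact: cst_continuous.
by apply: continuous_min; [exact: cst_continuous|exact: cvg_id].
Qed.

Lemma continuous_clamp (T : topologicalType) (f : R -> T) :
  {within `[0, 1], continuous f} -> continuous (f \o clamp).
Proof.
move=> /subspace_continuousP cf t; have ct := clamp_itv t.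
have /cf cft : `[0, 1]%classic (clamp t) by rewrite /= in_itv.
move=> A /cft; rewrite /= !nbhs_simpl /within /= => /clamp_continuous.
rewrite !nbhs_simpl /=.
apply: filterS => s /= h; apply: h; rewrite /= in_itv /=; exact: clamp_itv.
Qed.

Lemma itv_compact2 a b c d : compact (`[a, b] `*` `[c, d] : set (R * R)).
Proof. by apply: compact_setX; exact: segment_compact. Qed.

Lemma curves_apart (f g : R -> R * R) a b c d : continuous f -> continuous g ->
  (forall s t, a <= s <= b -> c <= t <= d -> f s <> g t) ->
  exists2 e, 0 < e & forall s t, a <= s <= b -> c <= t <= d -> e <= `|f s - g t|.
Proof.
move=> cf cg fg.
have [|k|e e0 eP] := @compact_positive _ (fun z : R * R => `|f z.1 - g z.2|)
  _ (@itv_compact2 a b c d).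
- apply: continuous_subspaceT => z; apply: cvg_norm; apply: cvgB.
    apply: continuous_comp; [exact: cvg_fst|exact: cf].
  apply: continuous_comp; [exact: cvg_snd|exact: cg].
- case: k => s t [/= ]; rewrite !in_itv /= => ss tt.
  by rewrite normr_gt0 subr_eq0; apply/eqP; exact: fg.
- by exists e => // s t ss tt; apply: (eP (s, t)); split; rewrite /= in_itv.
Qed.

(** The pairs of parameters whose images are at distance at least [e] form a
compact set away from the diagonal. *)
Lemma uniformly_continuous (f : R -> R * R) e : continuous f -> 0 < e ->
  exists2 d, 0 < d & forall s t, 0 <= s <= 1 -> 0 <= t <= 1 -> `|s - t| < d ->
    `|f s - f t| < e.
Proof.
move=> cf e0.
have cF : continuous (fun z : R * R => `|f z.1 - f z.2|).
  move=> z; apply: cvg_norm; apply: cvgB.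
    apply: continuous_comp; [exact: cvg_fst|exact: cf].
  apply: continuous_comp; [exact: cvg_snd|exact: cf].
pose K := (`[0, 1] `*` `[0, 1] : set (R * R)) `&` [set z | e <= `|f z.1 - f z.2|].
have cK : compact K.
  apply: compact_closedI; first exact: itv_compact2.
  apply: (@closed_comp _ _ (fun z : R * R => `|f z.1 - f z.2|)
    [set x | e <= x]) => [z _|].
    exact: cF.
  exact: closed_ge.
have [||d d0 dP] := @compact_positive _ (fun z : R * R => `|z.1 - z.2|) K cK.
- apply: continuous_subspaceT => z; apply: cvg_norm; apply: cvgB.
    exact: cvg_fst.
  exact: cvg_snd.
- move=> [s t] [_ /= le_e]; rewrite normr_gt0 subr_eq0; apply/eqP => st.
  by move: le_e; rewrite st subrr normr0 leNgt e0.
exists d => // s t ss tt std; rewrite ltNge; apply/negP => le_e.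
have := dP (s, t); rewrite leNgt std => -/(_ _)/notF; apply.
by split; [split; rewrite /= in_itv|].
Qed.

Lemma family_apart (T : finType) (f : T -> R -> R * R) (rel : T -> T -> bool) a b c d :
  (forall i, continuous (f i)) ->
  (forall i j s t, rel i j -> a <= s <= b -> c <= t <= d -> f i s <> f j t) ->
  exists2 e, 0 < e & forall k, 0 < k -> k <= e -> forall i j s t, rel i j ->
    a <= s <= b -> c <= t <= d -> 3 * k <= `|f i s - f j t|.
Proof.
move=> cf fapart.
have [|e e0 eP] := @finite_radius (T * T)%type (fun ij k => rel ij.1 ij.2 ->
    forall s t, a <= s <= b -> c <= t <= d -> 3 * k <= `|f ij.1 s - f ij.2 t|).
  move=> [i j] /=; case: (boolP (rel i j)) => [ij|_]; last by exists 1.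
  have [s t|e e0 eP] := @curves_apart _ _ a b c d (cf i) (cf j).
    exact: fapart.
  exists (e / 3) => [|k k0 ke _ s t ss tt]; first by rewrite divr_gt0.
  by apply: le_trans (eP s t ss tt); rewrite mulrC -ler_pdivlMr.
by exists e => // k k0 ke i j s t ij; exact: (eP k k0 ke (i, j)).
Qed.

Lemma family_bounded (T : finType) (f : T -> R -> R * R) :
  (forall i, continuous (f i)) ->
  exists M, forall i t, 0 <= t <= 1 -> `|f i t| <= M.
Proof.
move=> cf; have /choice[c cP] : forall i, exists c, forall t, 0 <= t <= 1 ->
    `|f i t| <= `|f i c|.
  move=> i; have [||c _ cmax] := @EVT_max R (fun t => `|f i t|) 0 1.
  - exact: ler01.
  - by apply: continuous_subspaceT => t; apply: cvg_norm; exact: cf.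
  by exists c => t tt; apply: cmax; rewrite in_itv.
exists (\sum_i `|f i (c i)|) => i t tt; apply: le_trans (cP i t tt) _.
by rewrite (bigD1 i) //= lerDl sumr_ge0.
Qed.

(** Index of the interval of length [k] that contains [a]; the shift by [M]
makes the coordinates in use nonnegative, and indices start from 1 so that the
border of the quadrant stays free. *)
Definition cell (k M a : R) : nat := (Num.truncn ((a + M) / k)).+1.

Section Cell.
Variables (k M : R).
Hypothesis k0 : 0 < k.

Lemma cell_itv a : 0 <= a + M ->
  (cell k M a)%:R * k <= a + M + k /\ a + M < (cell k M a)%:R * k.
Proof.
move=> a0; have /truncn_itv : 0 <= (a + M) / k by rewrite divr_ge0 // ltW.
rewrite ler_pdivlMr // ltr_pdivrMr // => /andP[h1 h2]; split=> //.
by rewrite -natr1 mulrDl mul1r lerD2r.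
Qed.

Lemma cell_eq_dist a b : 0 <= a + M -> 0 <= b + M -> cell k M a = cell k M b ->
  `|a - b| < k.
Proof.
by move=> /cell_itv + /cell_itv + eqab; rewrite eqab ltr_norml => -[] ? ? [] ? ?; lra.
Qed.

Lemma cell_near a b : 0 <= a + M -> 0 <= b + M -> `|a - b| < k ->
  (cell k M a <= (cell k M b).+1)%N.
Proof.
move=> /cell_itv[a1 a2] /cell_itv[b1 b2]; rewrite ltr_norml => ab.
move: (cell k M a) (cell k M b) a1 a2 b1 b2 => ca cb a1 a2 b1 b2.
rewrite -ltnS -(ltr_nat R) -(ltr_pM2r k0) -!natr1; lra.
Qed.

Lemma cell_le a b : 0 <= a + M -> a <= b -> (cell k M a <= cell k M b)%N.
Proof.
move=> a0 ab; have /cell_itv[b1 b2] : 0 <= b + M by lra.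
have [a1 a2] := cell_itv a0.
move: (cell k M a) (cell k M b) a1 a2 b1 b2 => ca cb a1 a2 b1 b2.
rewrite -ltnS -(ltr_nat R) -(ltr_pM2r k0) -natr1; lra.
Qed.

End Cell.

Lemma grid_adj_horiz i i' j : (i <= i'.+1)%N -> (i' <= i.+1)%N ->
  (i, j) = (i', j) \/ grid_adj (i, j) (i', j).
Proof.
move=> h h'; have [->|] := eqVneq i i'; [by left|right].
have [->|->] : i' = i.+1 \/ i = i'.+1 by lia.
  by exists (true, (i, j)); left.
by exists (true, (i', j)); right.
Qed.

Lemma grid_adj_vert i j j' : (j <= j'.+1)%N -> (j' <= j.+1)%N ->
  (i, j) = (i, j') \/ grid_adj (i, j) (i, j').
Proof.
move=> h h'; have [->|] := eqVneq j j'; [by left|right].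
have [->|->] : j' = j.+1 \/ j = j'.+1 by lia.
  by exists (false, (i, j)); left.
by exists (false, (i, j')); right.
Qed.

Section Sampling.
Variable h : nat.
Hypothesis h0 : (0 < h)%N.

Definition time m : R := m%:R / h.*2%:R.

Lemma time_itv m : (m <= h.*2)%N -> 0 <= time m <= 1.
Proof.
move=> mh; rewrite /time divr_ge0 ?ler0n //= ler_pdivrMr ?mul1r ?ler_nat //.
by rewrite ltr0n double_gt0.
Qed.

Lemma time_half m : (time m <= 1 / 2) = (m <= h)%N.
Proof.
by rewrite /time ler_pdivrMr ?ltr0n ?double_gt0 // -mul2n natrM mul1r mulKf ?ler_nat //.
Qed.

Lemma half_time m : (1 / 2 <= time m) = (h <= m)%N.
Proof.
by rewrite /time ler_pdivlMr ?ltr0n ?double_gt0 // -mul2n natrM mul1r mulKf ?ler_nat //.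
Qed.

Lemma head_index m : (m < h.*2)%N -> (m <= h.*2.*2)%N.
Proof. by move=> mh; rewrite (leq_trans (ltnW mh)) // -[leqRHS]addnn leq_addr. Qed.

Lemma tail_index m : (h.*2 <= m <= h.*2.*2)%N -> (m <= h.*2.*2)%N.
Proof. by case/andP. Qed.

Lemma first_half m : (m < h.*2)%N -> 0 <= time m./2 <= 1 / 2.
Proof.
move=> mh; have /andP[-> _] : 0 <= time m./2 <= 1 by apply: time_itv; lia.
by rewrite time_half; lia.
Qed.

Lemma second_half m : (h.*2 <= m <= h.*2.*2)%N -> 1 / 2 <= time m./2 <= 1.
Proof.
move=> mh; have /andP[_ ->] : 0 <= time m./2 <= 1 by apply: time_itv; lia.
by rewrite half_time andbT; lia.
Qed.

Lemma time0 : time 0 = 0.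
Proof. by rewrite /time mul0r. Qed.

Lemma time1 : time h.*2 = 1.
Proof. by rewrite /time divff // pnatr_eq0 double_eq0 -lt0n. Qed.

Lemma time_step m : `|time m - time m.+1| = 1 / h.*2%:R.
Proof.
rewrite /time -mulrBl -natr1 opprD addrA subrr add0r normrM normrN1.
by rewrite ger0_norm ?invr_ge0 ?ler0n.
Qed.

End Sampling.

Section Trace.
Variables (k M : R) (h : nat).
Hypotheses (k0 : 0 < k) (h0 : (0 < h)%N).
Local Notation time := (time h).

(** Samples at the times [j / (2 h)], rounded to the lattice.  Each sample gives
two points of the walk: the first coordinate moves to the next sample one step
before the second one, so that consecutive points differ in one coordinate
only. *)
Definition trace (f : R -> R * R) m : node :=
  (cell k M (f (time (uphalf m))).1, cell k M (f (time m./2)).2).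

Variable f : R -> R * R.
Hypothesis f_bounded : forall t, 0 <= t <= 1 -> `|f t| <= M.
Hypothesis f_steps : forall m, (m < h.*2)%N ->
  `|f (time m) - f (time m.+1)| < k.

Lemma coord_bounds t : 0 <= t <= 1 ->
  [/\ 0 <= (f t).1 + M, 0 <= (f t).2 + M, (f t).1 <= M & (f t).2 <= M].
Proof.
move/f_bounded; rewrite prod_normE ge_max !ler_norml.
by move=> /andP[/andP[h1 h2] /andP[h3 h4]]; split=> //; lra.
Qed.

Lemma coord_steps m : (m < h.*2)%N ->
  `|(f (time m)).1 - (f (time m.+1)).1| < k /\
  `|(f (time m)).2 - (f (time m.+1)).2| < k.
Proof. by move/f_steps; rewrite prod_normE gt_max => /andP[]. Qed.

Lemma trace_box m : (m <= h.*2.*2)%N ->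
  [&& 0 < (trace f m).1 < (cell k M M).+1 & 0 < (trace f m).2 < (cell k M M).+1]%N.
Proof.
move=> mK.
have [|x0 _ x1 _] := @coord_bounds (time (uphalf m)).
  by apply: time_itv; lia.
have [|_ y0 _ y1] := @coord_bounds (time m./2).
  by apply: time_itv; lia.
by apply/andP; split; apply/andP; split=> //; rewrite ltnS; apply: cell_le.
Qed.

Lemma trace_step m : (m < h.*2.*2)%N ->
  trace f m = trace f m.+1 \/ grid_adj (trace f m) (trace f m.+1).
Proof.
move=> mK; have b1 : 0 <= time m./2 <= 1 by apply: time_itv; lia.
have b2 : 0 <= time m./2.+1 <= 1 by apply: time_itv; lia.
have [x0 y0 _ _] := coord_bounds b1; have [x0' y0' _ _] := coord_bounds b2.
have [|dx dy] := @coord_steps m./2; first lia.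
rewrite /trace; case: (boolP (odd m)) => om.
  have -> : uphalf m = m./2.+1 by rewrite uphalf_half om.
  have -> : uphalf m.+1 = m./2.+1 by rewrite /=.
  have -> : m.+1./2 = m./2.+1 by rewrite -uphalfE uphalf_half om.
  apply: grid_adj_vert; apply: cell_near => //; by rewrite distrC.
have -> : uphalf m = m./2 by rewrite uphalf_half (negPf om).
have -> : uphalf m.+1 = m./2.+1 by rewrite /=.
have -> : m.+1./2 = m./2 by rewrite -uphalfE uphalf_half (negPf om).
apply: grid_adj_horiz; apply: cell_near => //; by rewrite distrC.
Qed.

Lemma trace_coords m : (m <= h.*2.*2)%N ->
  `|(f (time m./2)).1 - (f (time (uphalf m))).1| < k.
Proof.
move=> mK; rewrite uphalf_half; case: (boolP (odd m)) => om.
  have [|] // := @coord_steps m./2; lia.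
by rewrite add0n subrr normr0.
Qed.

End Trace.

(** In each coordinate, two points in the same cell are at distance less than
[k]; the first coordinates may in addition be one sample ahead, which costs at
most [k] on each curve. *)
Lemma trace_eq_dist k M h (f f' : R -> R * R) m m' : 0 < k -> (0 < h)%N ->
  (forall t, 0 <= t <= 1 -> `|f t| <= M) ->
  (forall t, 0 <= t <= 1 -> `|f' t| <= M) ->
  (forall m, (m < h.*2)%N -> `|f (time h m) - f (time h m.+1)| < k) ->
  (forall m, (m < h.*2)%N -> `|f' (time h m) - f' (time h m.+1)| < k) ->
  (m <= h.*2.*2)%N -> (m' <= h.*2.*2)%N ->
  trace k M h f m = trace k M h f' m' ->
  `|f (time h m./2) - f' (time h m'./2)| < 3 * k.
Proof.
move=> k0 h0 fM fM' fk fk' mK mK' eqt.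
have eqx := congr1 fst eqt; have eqy := congr1 snd eqt.
have tt j : (j <= h.*2.*2)%N -> 0 <= time h (uphalf j) <= 1 /\ 0 <= time h j./2 <= 1.
  by move=> jK; split; apply: time_itv => //; lia.
have [u1 l1] := tt m mK; have [u2 l2] := tt m' mK'.
have [x0 _ _ _] := coord_bounds fM u1; have [x0' _ _ _] := coord_bounds fM' u2.
have [_ y0 _ _] := coord_bounds fM l1; have [_ y0' _ _] := coord_bounds fM' l2.
have dx := cell_eq_dist k0 x0 x0' eqx; have dy := cell_eq_dist k0 y0 y0' eqy.
have c1 := trace_coords k0 h0 fk mK; have c2 := trace_coords k0 h0 fk' mK'.
rewrite prod_normE gt_max /=; move: dx dy c1 c2; rewrite !ltr_norml.
move=> /andP[? ?] /andP[? ?] /andP[? ?] /andP[? ?].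
by apply/andP; split; apply/andP; split; lra.
Qed.

End Approximation.

(** * Curves in the plane *)

Section Drawing.
Local Open Scope ring_scope.
Local Open Scope classical_set_scope.
Variable R : realType.

(** Halving the curves at time 1/2 gives the heads and tails of the walks.  The
last condition makes each walk start outside the blob in which it ends, so that
it has a last point before its first visit to that blob. *)
Theorem curves_card (U W : finType) (E : {set U * W}) (V : {set U + W})
    (curve : U * W -> R -> R * R) (left_end : U -> R * R) (right_end : W -> R * R) :
  (forall e, e \in E -> inl e.1 \in V /\ inr e.2 \in V) ->
  (forall e, continuous (curve e)) ->
  (forall e, e \in E -> curve e 0 = left_end e.1) ->
  (forall e, e \in E -> curve e 1 = right_end e.2) ->
  (forall e e' s t, e \in E -> e' \in E -> e.1 != e'.1 ->
     0 <= s <= 1 / 2 -> 0 <= t <= 1 / 2 -> curve e s <> curve e' t) ->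
  (forall e e' s t, e \in E -> e' \in E -> e.2 != e'.2 ->
     1 / 2 <= s <= 1 -> 1 / 2 <= t <= 1 -> curve e s <> curve e' t) ->
  (forall e e' s t, e \in E -> e' \in E -> e.2 != e'.2 ->
     0 <= s <= 1 / 2 -> 1 / 2 <= t <= 1 -> curve e s <> curve e' t) ->
  (forall e e' t, e \in E -> e' \in E -> 1 / 2 <= t <= 1 ->
     curve e 0 <> curve e' t) ->
  (#|E| <= 2 * #|V|)%N.
Proof.
move=> EV cc c0 c1 heads tails mixed starts.
have [|k1 k1_gt0 apart1] := family_apart (f := curve)
    (rel := fun e e' => [&& e \in E, e' \in E & e.1 != e'.1])
    (a := 0) (b := 1 / 2) (c := 0) (d := 1 / 2) cc.
  by move=> e e' s t /and3P[eE e'E ne]; apply: heads.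
have [|k2 k2_gt0 apart2] := family_apart (f := curve)
    (rel := fun e e' => [&& e \in E, e' \in E & e.2 != e'.2])
    (a := 1 / 2) (b := 1) (c := 1 / 2) (d := 1) cc.
  by move=> e e' s t /and3P[eE e'E ne]; apply: tails.
have [|k3 k3_gt0 apart3] := family_apart (f := curve)
    (rel := fun e e' => [&& e \in E, e' \in E & e.2 != e'.2])
    (a := 0) (b := 1 / 2) (c := 1 / 2) (d := 1) cc.
  by move=> e e' s t /and3P[eE e'E ne]; apply: mixed.
have [|k4 k4_gt0 apart4] := family_apart (f := curve)
    (rel := fun e e' => (e \in E) && (e' \in E))
    (a := 0) (b := 0) (c := 1 / 2) (d := 1) cc.
  move=> e e' s t /andP[eE e'E]; rewrite -eq_le => /eqP <-; exact: starts.
(* A mesh [k] for which points that must stay apart are [3 * k] apart. *)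
pose k := Num.min (Num.min k1 k2) (Num.min k3 k4).
have k0 : 0 < k by rewrite !lt_min k1_gt0 k2_gt0 k3_gt0.
have [kk1 kk2 kk3 kk4] : [/\ k <= k1, k <= k2, k <= k3 & k <= k4].
  by rewrite !ge_min !lexx !orbT.
have [|w w0 wP] := @finite_radius R (U * W)%type (fun e d => forall s t,
    0 <= s <= 1 -> 0 <= t <= 1 -> `|s - t| < d -> `|curve e s - curve e t| < k).
  move=> e; have [w w0 wP] := uniformly_continuous (cc e) k0.
  exists w => // d d0 dw s t ss tt std; apply: wP => //.
  exact: lt_le_trans dw.
have [M curveM] := family_bounded cc.
(* The sampling step [1 / (2 h)] is small enough for the curves to move by less
   than [k] between samples. *)
pose h := (Num.truncn w^-1).+1.
have h0 : (0 < h)%N by [].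
have hw : 1 / h.*2%:R < w.
  have /truncn_itv/andP[_ wh] : 0 <= w^-1 by rewrite invr_ge0 ltW.
  rewrite div1r -(invrK w) ltf_pV2 ?posrE ?invr_gt0 ?ltr0n ?double_gt0 //.
  by apply: lt_le_trans wh _; rewrite ler_nat -addnn leq_addr.
have steps e m : (m < h.*2)%N ->
    `|curve e (time R h m) - curve e (time R h m.+1)| < k.
  move=> mh; apply: (wP w) => //; rewrite ?time_step //; apply: time_itv => //.
  exact: ltnW.
have near e e' m m' := @trace_eq_dist R k M h (curve e) (curve e') m m' k0 h0
  (curveM e) (curveM e') (steps e) (steps e').
have far e e' m m' : (m <= h.*2.*2)%N -> (m' <= h.*2.*2)%N ->
    3 * k <= `|curve e (time R h m./2) - curve e' (time R h m'./2)| ->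
    trace k M h (curve e) m <> trace k M h (curve e') m'.
  by move=> mK m'K; rewrite leNgt => /negP far /(near _ _ _ _ mK m'K).
apply: (@walk_model_card U W E V (fun e => trace k M h (curve e))
  (cell k M M).+1 h.*2 h.*2.*2) => //.
- by rewrite -[leqRHS]addnn leq_addr.
- by move=> e m eE; apply: trace_box => //; apply: curveM.
- by move=> e m eE; apply: trace_step => //; [apply: curveM|apply: steps].
- by move=> e e' eE e'E ee; rewrite /trace /= time0 !c0 // ee.
- move=> e e' eE e'E ee; rewrite /trace uphalf_double doubleK time1 //.
  by rewrite !c1 // ee.
- move=> e e' m m' eE e'E ee mN m'N; apply: far;
    [exact: head_index|exact: head_index|].
  by apply: (apart1 k k0 kk1); rewrite ?first_half // eE e'E.
- move=> e e' m m' eE e'E ee mN m'N; apply: far;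
    [exact: tail_index|exact: tail_index|].
  by apply: (apart2 k k0 kk2); rewrite ?second_half // eE e'E.
- move=> e e' m m' eE e'E ee mN m'N; apply: far;
    [exact: head_index|exact: tail_index|].
  by apply: (apart3 k k0 kk3); rewrite ?first_half ?second_half // eE e'E.
- move=> e e' m' eE e'E m'N; apply: far => //; first exact: tail_index.
  have := apart4 k k0 kk4 e e' 0 (time R h m'./2); rewrite eE e'E lexx /= time0.
  by apply; rewrite ?second_half.
Qed.

Variables (G : sgraph) (X : {set G}).
Hypothesis bipX : forall u v : G, adj u v -> (u \in X) != (v \in X).
Variables (pos : G -> R * R) (arc : {set G} -> R -> R * R).
Hypothesis drawing : plane_drawing pos arc.
Implicit Types (e : G * G) (s t : R).

(** The arc of an edge may run in either direction; the edges of the bipartite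
graph are traversed from [X] to its complement. *)
Lemma directed_arc (x y : G) : adj x y -> exists f : R -> R * R,
  [/\ continuous f, f 0 = pos x, f 1 = pos y,
      forall s t, 0 <= s <= 1 -> 0 <= t <= 1 -> f s = f t -> s = t
    & forall t, 0 < t < 1 -> exists2 t', 0 < t' < 1 & f t = arc [set x; y]%SET t'].
Proof.
move=> axy; have [_ arcs _ _] := drawing.
have eE : [set x; y]%SET \in edges G.
  by apply/imsetP; exists (x, y) => //; rewrite inE.
have [carc iarc [u [v [euv arc0 arc1]]]] := arcs _ eE.
set S := [set x; y]%SET in eE carc iarc euv arc0 arc1 *.
have inj s t : 0 <= s <= 1 -> 0 <= t <= 1 -> arc S s = arc S t -> s = t.
  by move=> ss tt; apply: iarc; rewrite in_itv.
have itv0 : 0 <= (0 : R) <= 1 by rewrite lexx ler01.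
have itv1 : 0 <= (1 : R) <= 1 by rewrite lexx ler01.
have itv_rev t : 0 <= t <= 1 -> 0 <= 1 - t <= 1.
  by move=> /andP[t0 t1]; rewrite subr_ge0 t1 gerBl t0.
have cf := continuous_clamp carc.
have [[xu yv]|[xv yu]] := eq_set2 euv; [exists (arc S \o clamp (R := R))|
  exists ((arc S \o clamp (R := R)) \o (fun t => 1 - t))]; split => //=.
- by rewrite clamp_id // arc0 xu.
- by rewrite clamp_id // arc1 yv.
- by move=> s t ss tt; rewrite !clamp_id //; apply: inj.
- move=> t /andP[t0 t1]; exists t; first by rewrite t0.
  by rewrite clamp_id // !ltW.
- move=> t; apply: continuous_comp; last exact: cf.
  by apply: cvgB; [exact: cvg_cst|exact: cvg_id].
- by rewrite subr0 clamp_id // arc1 xv.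
- by rewrite subrr clamp_id // arc0 yu.
- move=> s t ss tt; rewrite !clamp_id ?itv_rev // => /inj.
  move=> /(_ (itv_rev _ ss) (itv_rev _ tt)) /(congr1 (fun z => 1 - z)).
  by rewrite !subKr.
- move=> t /andP[t0 t1]; exists (1 - t); first by rewrite subr_gt0 t1 gtrBl.
  by rewrite clamp_id // itv_rev // !ltW.
Qed.

Lemma drawn_bipartite_card (E : {set G * G}) (V : {set G + G}) :
  (forall e, e \in E -> [/\ adj e.1 e.2, e.1 \in X & e.2 \notin X]) ->
  (forall e, e \in E -> inl e.1 \in V /\ inr e.2 \in V) ->
  (#|E| <= 2 * #|V|)%N.
Proof.
move=> EX EV; have [pos_inj arcs no_vertex no_cross] := drawing.
have /choice[f fP] : forall e, exists f : R -> R * R, continuous f /\ (e \in E ->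
  [/\ f 0 = pos e.1, f 1 = pos e.2,
      forall s t, 0 <= s <= 1 -> 0 <= t <= 1 -> f s = f t -> s = t
    & forall t, 0 < t < 1 -> exists2 t', 0 < t' < 1 & f t = arc [set e.1; e.2]%SET t']).
  move=> e; case: (boolP (e \in E)) => [/EX[/directed_arc[f [cf f0 f1 finj fint]] _ _]|_].
    by exists f.
  by exists (fun=> 0); split=> //; exact: cst_continuous.
have edgeE e : e \in E -> [set e.1; e.2]%SET \in edges G.
  by move=> /EX[ae _ _]; apply/imsetP; exists e => //; rewrite inE.
have edge_inj e e' : e \in E -> e' \in E -> e != e' ->
    [set e.1; e.2]%SET != [set e'.1; e'.2]%SET.
  move=> /EX[_ e1 _] /EX[_ _ e2']; apply: contraNneq => /eq_set2 [[]|[ee _]].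
    by case: e {e1} => ? ?; case: e' {e2'} => ? ? /= -> ->.
  by rewrite ee (negPf e2') in e1.
have ends t : 0 <= t <= 1 -> ~~ (0 < t < 1) -> t = 0 \/ t = 1.
  rewrite !le_eqVlt negb_and => /andP[/orP[/eqP<-|->] /orP[/eqP->|->]] //;
    by [left|right].
have interior_free e e' s t : e \in E -> e' \in E -> e != e' ->
    0 < s < 1 -> 0 <= t <= 1 -> f e s <> f e' t.
  move=> eE e'E ne s01 t01.
  have [_ /(_ eE)[_ _ _ /(_ s s01)[s' s'01 ->]]] := fP e.
  have [_ /(_ e'E)[f0 f1 _ fint]] := fP e'.
  case: (boolP (0 < t < 1)) => [/fint[t' t'01 ->]|/(ends t t01)[->|->]].
  - by apply: no_cross => //; [exact: edgeE|exact: edgeE|exact: edge_inj].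
  - by rewrite f0; apply: no_vertex => //; exact: edgeE.
  - by rewrite f1; apply: no_vertex => //; exact: edgeE.
(* All the disjointness conditions follow: arcs of different edges only share
   end points, and these are images of vertices. *)
have meet_at_ends e e' s t : e \in E -> e' \in E -> e != e' ->
    0 <= s <= 1 -> 0 <= t <= 1 -> f e s = f e' t ->
    (s = 0 \/ s = 1) /\ (t = 0 \/ t = 1).
  move=> eE e'E ne ss tt st; split; apply: ends => //; apply/negP => h.
    exact: (interior_free e e' s t).
  by apply: (interior_free e' e t s) => //; rewrite eq_sym.
have lo s : 0 <= s <= 1 / 2 -> 0 <= s <= 1 by lra.
have hi s : 1 / 2 <= s <= 1 -> 0 <= s <= 1 by lra.
have lo0 s : 0 <= s <= 1 / 2 -> s = 0 \/ s = 1 -> s = 0.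
  by move=> /andP[_ s2] [] // s1; move: s2; rewrite s1; lra.
have hi1 s : 1 / 2 <= s <= 1 -> s = 0 \/ s = 1 -> s = 1.
  by move=> /andP[s2 _] [] // s1; move: s2; rewrite s1; lra.
have neq1 e e' : e.1 != e'.1 -> e != e' by apply: contraNneq => ->.
have neq2 e e' : e.2 != e'.2 -> e != e' by apply: contraNneq => ->.
have left_right e e' : e \in E -> e' \in E -> pos e.1 <> pos e'.2.
  by move=> /EX[_ e1 _] /EX[_ _ e2'] /pos_inj ee; rewrite ee (negPf e2') in e1.
have at0 e : e \in E -> f e 0 = pos e.1 by have [_ h] := fP e => /h[].
have at1 e : e \in E -> f e 1 = pos e.2 by have [_ h] := fP e => /h[].
apply: (@curves_card G G E V f pos pos) => //.
- by move=> e; have [] := fP e.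
- move=> e e' s t eE e'E ne ss tt st.
  have [s0 t0] := meet_at_ends e e' s t eE e'E (neq1 _ _ ne) (lo s ss) (lo t tt) st.
  move: st; rewrite (lo0 s ss s0) (lo0 t tt t0) !at0 // => /pos_inj ee.
  by rewrite ee eqxx in ne.
- move=> e e' s t eE e'E ne ss tt st.
  have [s0 t0] := meet_at_ends e e' s t eE e'E (neq2 _ _ ne) (hi s ss) (hi t tt) st.
  move: st; rewrite (hi1 s ss s0) (hi1 t tt t0) !at1 // => /pos_inj ee.
  by rewrite ee eqxx in ne.
- move=> e e' s t eE e'E ne ss tt st.
  have [s0 t0] := meet_at_ends e e' s t eE e'E (neq2 _ _ ne) (lo s ss) (hi t tt) st.
  move: st; rewrite (lo0 s ss s0) (hi1 t tt t0) at0 // at1 //.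
  exact: left_right.
- move=> e e' t eE e'E tt; have tt' := hi t tt.
  have [<-|ne] := eqVneq e e' => st.
    have [_ /(_ eE)[_ _ inj _]] := fP e.
    have t0 : 0 = t by apply: inj => //; rewrite lexx ler01.
    by move: tt; rewrite -t0; lra.
  have [|_ t0] := meet_at_ends e e' 0 t eE e'E ne _ tt' st.
    by rewrite lexx ler01.
  move: st; rewrite (hi1 t tt t0) at0 // at1 //; exact: left_right.
Qed.

End Drawing.

(** * Sparsity of bipartite planar graphs *)

Lemma planar_bipartite_sparse (R : realType) (G : sgraph) (X V : {set G}) :
  (forall u v : G, adj u v -> (u \in X) != (v \in X)) -> planar R G ->
  #|[set e in edges G | e \subset V]| <= 2 * #|V|.
Proof.
move=> bipX [pos [arc drawing]].
pose E := [set e : G * G | [&& adj e.1 e.2, e.1 \in V :&: X & e.2 \in V :\: X]].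
pose L := [set inl x | x in V :&: X] :|: [set inr y | y in V :\: X] : {set G + G}.
have leE : #|E| <= 2 * #|L|.
  apply: (drawn_bipartite_card (X := X) drawing) => [e|e].
    by rewrite !inE => /and3P[-> /andP[_ ->] /andP[-> _]].
  by rewrite inE => /and3P[_ eX eY]; rewrite !inE !imset_f ?orbT.
have leL : #|L| <= #|V|.
  rewrite -(cardsID X V); apply: leq_trans (leq_card_setU _ _) _.
  by rewrite leq_add ?leq_imset_card.
have sub : [set e in edges G | e \subset V] \subset
    [set [set e.1; e.2] | e in E].
  apply/subsetP => S; rewrite inE => /andP[/imsetP[[u v]]].
  rewrite inE /= => auv -> ; rewrite subUset !sub1set => /andP[uV vV].
  have := bipX _ _ auv; case: (boolP (u \in X)) => uX; case: (boolP (v \in X)) => vX // _.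
    by apply/imsetP; exists (u, v); rewrite // !inE /= auv uV vV uX vX.
  apply/imsetP; exists (v, u); last by rewrite /= setUC.
  by rewrite !inE /= adj_sym auv uV vV uX vX.
apply: leq_trans (subset_leq_card sub) _; apply: leq_trans (leq_imset_card _ _) _.
by apply: leq_trans leE _; rewrite leq_mul2l leL orbT.
Qed.

Theorem theorem3 (R : realType) (G : sgraph) :
  bipartite G -> planar R G -> 3 <= min_degree G ->
  proper_orientation_number G <= 3.
Proof.
move=> [X bipX] planarG deg3.
have [A oA degA] := bounded_indegree_orientation (fun V =>
  planar_bipartite_sparse V bipX planarG).
rewrite /proper_orientation_number; case: ex_minnP => k _; apply.
exact: saturate_side bipX oA degA deg3.
Qed.
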